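(* Let $f, g \colon \mathbb{R}^n \to \mathbb{R}^n$ be polynomial maps of positive degrees $d_f$ and $d_g$, respectively, and let $\mathfrak{m}^\infty(x) := \min\{f^\infty(x), g^\infty(x)\}$ (componentwise minimum). Suppose there exists a vector $x^{\mathrm{ref}} \in \mathbb{R}^n$ such that the set $$\{x \in \mathbb{R}^n : \langle x - x^{\mathrm{ref}}, \mathfrak{m}^\infty(x) \rangle \le 0\}$$ is bounded. Then, for any polynomial maps $p, q \colon \mathbb{R}^n \to \mathbb{R}^n$ of degrees at most $d_f - 1$ and $d_g - 1$ respectively, the set $\mathrm{SOL}(f + p, g + q)$ is nonempty and compact.
   Context: A polynomial map $f\colon\mathbb{R}^n\to\mathbb{R}^n$ is written $f=\mathcal{A}_d+\mathcal{A}_{d-1}+\cdots+\mathcal{A}_0$ with each $\mathcal{A}_k\colon\mathbb{R}^n\to\mathbb{R}^n$ a polynomial map homogeneous of degree $k$; if $\mathcal{A}_d\neq 0$, the degree of $f$ is $d$ and its leading term is $f^\infty:=\mathcal{A}_d$ (homogeneous part of highest degree of the whole map). For polynomial maps $f,g\colon\mathbb{R}^n\to\mathbb{R}^n$, $\mathrm{SOL}(f,g):=\{x\in\mathbb{R}^n : f(x)\ge 0,\ g(x)\ge 0,\ \langle f(x),g(x)\rangle=0\}$, with vector inequalities componentwise. *)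

(* Defs.v *)
From HB Require Import structures.
From mathcomp Require Import all_boot all_order all_algebra.
From mathcomp Require Import all_classical all_reals all_analysis.
(* The notations of mpoly clash with those of all_analysis. *)
From mathcomp Require Import -(notations) mpoly.
Set Implicit Arguments.
Unset Strict Implicit.
Unset Printing Implicit Defensive.
Import Order.TTheory GRing.Theory Num.Theory.
Import numFieldNormedType.Exports.
Local Open Scope classical_set_scope.
Local Open Scope ring_scope.

(* A polynomial map R^n -> R^n is the row of its n coordinate polynomials;
   over an infinite field the polynomials are determined by the map. *)
Notation polymap R n := 'rV[mpoly n R]_n.

Section PolynomialMaps.
Variables (R : realType) (n : nat).
Implicit Types (f g : polymap R n) (x u v : 'rV[R]_n).

Definition pm_eval f x : 'rV[R]_n := map_mx (meval (x 0)) f.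

(* [mmeasure mdeg p] is 1 + the total degree of p, or 0 if p = 0; as for
   [size], the degree of the zero map is therefore taken to be 0. *)
Definition pm_degree f : nat :=
  \max_(i < n) (mmeasure mdeg (f 0%R i)).-1.

Definition pm_homog (k : nat) f : polymap R n :=
  map_mx (pihomog mdeg k) f.

(* The homogeneous part has the degree of the whole map, not that of each
   coordinate, so some coordinates of the leading term may vanish. *)
Definition leading_term f : polymap R n := pm_homog (pm_degree f) f.

Definition dotprod u v : R := \sum_(i < n) u 0 i * v 0 i.

Definition cmin u v : 'rV[R]_n := map2_mx Num.min u v.

Definition cnonneg u : Prop := forall i, 0 <= u 0 i.

Definition SOL f g : set 'rV[R]_n :=
  [set x | [/\ cnonneg (pm_eval f x), cnonneg (pm_eval g x)
             & dotprod (pm_eval f x) (pm_eval g x) = 0]].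

Definition min_leading f g x : 'rV[R]_n :=
  cmin (pm_eval (leading_term f) x) (pm_eval (leading_term g) x).

End PolynomialMaps.

(* Main.v *)
Require Import Defs.
From mathcomp Require Import all_boot all_order all_algebra.
From mathcomp Require Import all_classical all_reals all_analysis.
From mathcomp Require Import -(notations) mpoly.
From mathcomp Require Import lra.
Import Order.TTheory GRing.Theory Num.Theory.
Import numFieldNormedType.Exports.
Local Open Scope classical_set_scope.
Local Open Scope ring_scope.
Set Implicit Arguments.
Unset Strict Implicit.
Unset Printing Implicit Defensive.

(** A point belongs to [SOL F G] exactly when the componentwise minimum of
[F] and [G] vanishes there ([SOL_cminE]), so a zero of
[min (f + p, g + q)] is wanted.

Deform it to the minimum of the leading terms by [blend]: for a parameter
[lambda] in [0, 1] take the zeros of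
[min (finf + lambda (f + p - finf), ginf + lambda (g + q - ginf))].  They are
bounded uniformly in [lambda] ([blend_zeros_bounded]).  Indeed, the vanishing
of a minimum survives scaling its two arguments by unrelated positive factors,
so at [x] one may divide by [|x| ^ deg f] and [|x| ^ deg g] separately, even
when the degrees differ; what is left is
[min (finf (u) + O(1/|x|), ginf (u) + O(1/|x|))] at [u = x / |x|], while
[min (finf, ginf)] is bounded away from 0 on the unit sphere: a zero [u] there
would put the whole ray through [u] into the set assumed to be bounded
([min_leading_sphere_lower_bound]).  Taking [lambda = 1] gives boundedness,
hence compactness, of the solution set.

For existence, let [lambda] depend on [x]: it is 1 for [|x| <= r] and 0 for
[|x| >= 2 r], with [r] large.  The resulting continuous map [F] satisfies a
variational inequality on the cube [|x| <= 2 r]: some [x] there has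
[<x - y, F x> <= 0] for all [y] in the cube, [xref] in particular.  If [x] were
on the boundary of the cube, [F x] would be the minimum of the leading terms
and the assumption would bound [|x|] by less than [2 r].  So [x] is interior,
[F x = 0], the uniform bound gives [|x| <= r], and there [F] is
[min (f + p, g + q)].

The variational inequality on a cube ([cube_variational_inequality]) is a form
of Brouwer's theorem.  It is obtained by compactness from a cubical Sperner
lemma ([cubical_sperner]): if every vertex of the grid [{0, ..., N}^n] carries
[n] bits, the [i]-th of which is 0 on the face [x_i = 0] and 1 on the face
[x_i = N], then in some elementary cube all [n] bits take both values.  This
is proved by a discrete Stokes formula modulo 2.  Regarding the bits as
0-cochains [l_1, ..., l_n] of the Kuhn triangulation of the grid, the cup
product of their coboundaries, [dl_1 dl_2 ... dl_n], is the coboundary of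
[l_1 dl_2 ... dl_n], and the latter vanishes on all faces of the big cube but
[x_1 = N], where it is [dl_2 ... dl_n].  By induction the cup product sums to
1, so it is nonzero on some elementary cube, where then no bit is constant. *)

(** * A cubical Sperner lemma *)

Local Notation del S j := (finset.setD S (finset.set1 j)).

Section Cup.
Variable I : finType.
Implicit Types (x y : I -> nat) (i j : I) (S : {set I}) (s : seq I).
Implicit Types (l F : (I -> nat) -> 'F_2) (ls : seq ((I -> nat) -> 'F_2)).

Definition step j x : I -> nat := fun i => (x i + (i == j))%N.

Definition upd x j (k : nat) : I -> nat := fun i => if i == j then k else x i.

(** The cup product of the coboundaries of the 0-cochains [ls], summed over
all simplices [x, x + e_i, x + e_i + e_j, ...] of the Kuhn triangulation of the
cube with least vertex [x] and edge directions [S]: the recursion chooses the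
first edge of such a monotone path.  Working
modulo 2 makes orientations irrelevant. *)
Fixpoint cup ls S x : 'F_2 :=
  if ls is l :: ls' then
    \sum_(j in S) (l (step j x) - l x) * cup ls' (del S j) (step j x)
  else 1.

Fixpoint boxsum N s F x : 'F_2 :=
  if s is j :: s' then \sum_(k < N) boxsum N s' F (upd x j k) else F x.

Lemma F2_addrr (a : 'F_2) : a + a = 0.
Proof. by apply: val_inj; case: a => -[|[|]]. Qed.

Lemma stepC i j x : step i (step j x) = step j (step i x).
Proof. by apply/funext => k; rewrite /step addnAC. Qed.

Lemma sum_pairs_exchange (A : I -> I -> 'F_2) S :
  \sum_(j in S) \sum_(i in del S j) A j i =
  \sum_(j in S) \sum_(i in del S j) A i j.
Proof.
rewrite (exchange_big_dep (mem S)) /=; last first.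
  by move=> i j _; rewrite !inE => /andP[].
apply: eq_bigr => j jS; apply: eq_bigl => i.
by rewrite !inE jS andbT eq_sym andbC.
Qed.

Lemma sum_square_sym (A : I -> I -> 'F_2) (r : seq I) :
  (forall i j, A i j = A j i) ->
  \sum_(j <- r) \sum_(i <- r) A j i = \sum_(j <- r) A j j.
Proof.
move=> Asym; elim: r => [|a r IH]; first by rewrite !big_nil.
rewrite !big_cons -IH.
have -> : \sum_(j <- r) \sum_(i <- a :: r) A j i =
          \sum_(j <- r) A a j + \sum_(j <- r) \sum_(i <- r) A j i.
  by rewrite -big_split; apply: eq_bigr => j _; rewrite big_cons Asym.
by rewrite -addrA [X in _ + X]addrA F2_addrr add0r.
Qed.

Lemma sum_pairs_sym (A : I -> I -> 'F_2) S : (forall i j, A i j = A j i) ->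
  \sum_(j in S) \sum_(i in del S j) A j i = 0.
Proof.
move=> Asym.
have -> : \sum_(j in S) \sum_(i in del S j) A j i =
          \sum_(j in S) (\sum_(i in S) A j i + A j j).
  apply: eq_bigr => j jS; rewrite (big_setD1 j jS) /= addrAC F2_addrr add0r.
  by [].
rewrite big_split /= -[X in X + _]big_enum -[X in _ + X]big_enum /=.
under eq_bigr do rewrite -big_enum.
by rewrite sum_square_sym // F2_addrr.
Qed.

(** A product of coboundaries is closed: its sum over the boundary of a cube,
that is over the far and the near faces, is zero.  The proof is an induction
on the number of factors, the two terms of each unordered pair of directions
cancelling. *)
Lemma cup_closed ls S x :
  \sum_(j in S) cup ls (del S j) (step j x) =
  \sum_(j in S) cup ls (del S j) x.
Proof.
elim: ls S x => [//|l ls IH] S x /=.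
pose B := \sum_(j in S) l (step j x) *
  \sum_(i in del S j) cup ls (del (del S j) i) (step j x).
have delC i j : del (del S j) i = del (del S i) j.
  by apply/setP => k; rewrite !inE andbCA.
(* [B] is what remains of the far faces once the values of [l] two steps away
   from [x] have cancelled. *)
transitivity B.
  have -> : B = \sum_(j in S) \sum_(i in del S j)
      (l (step i (step j x)) - (l (step i (step j x)) - l (step j x)))
        * cup ls (del (del S j) i) (step i (step j x)).
    apply: eq_bigr => j _; rewrite -IH big_distrr /=.
    by apply: eq_bigr => i _; rewrite subKr.
  apply/eqP; rewrite -subr_eq0 -sumrB.
  rewrite (eq_bigr (fun j => \sum_(i in del S j) l (step i (step j x)) *
     cup ls (del (del S j) i) (step i (step j x)))) ?sum_pairs_sym //.
    by move=> i j; rewrite stepC delC.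
  move=> j _; rewrite -sumrB; apply: eq_bigr => i _.
  by rewrite -mulrBl subKr -addrA -opprD F2_addrr subr0.
transitivity (B - l x *
  \sum_(j in S) \sum_(i in del S j) cup ls (del (del S j) i) x).
  rewrite (sum_pairs_sym (A := fun j i => cup ls (del (del S j) i) x)).
    by rewrite mulr0 subr0.
  by move=> i j; rewrite delC.
rewrite /B.
rewrite [in X in X = _](eq_bigr (fun j => \sum_(i in del S j)
  l (step j x) * cup ls (del (del S i) j) (step j x))); last first.
  by move=> j _; rewrite big_distrr /=; apply: eq_bigr => i _; rewrite delC.
rewrite (sum_pairs_exchange
  (fun j i => l (step j x) * cup ls (del (del S i) j) (step j x))).
rewrite big_distrr /= -sumrB; apply: eq_bigr => j _.
rewrite -IH big_distrr /= -sumrB; apply: eq_bigr => i _.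
by rewrite mulrBl.
Qed.

(** The coboundary formula [dl ls = d(l ls)] on one cube: by closedness of the
tail, the factor [cup ls] next to [l x] may be evaluated on near faces instead
of far ones, so that each direction contributes a difference that telescopes. *)
Lemma cup_stokes l ls S x :
  cup (l :: ls) S x =
  \sum_(j in S) (l (step j x) * cup ls (del S j) (step j x)
                 - l x * cup ls (del S j) x).
Proof.
rewrite sumrB -big_distrr /= -cup_closed big_distrr /= -sumrB.
by apply: eq_bigr => j _; rewrite mulrBl.
Qed.

Lemma step_neq i j x : i != j -> step j x i = x i.
Proof. by move=> /negbTE ij; rewrite /step ij addn0. Qed.

(** A cochain that is constant on the hyperplane through [x] normal to [j] has
zero coboundary along every path staying in this hyperplane. *)
Lemma cup_const ls l S j x : l \in ls -> j \notin S ->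
  (forall y z, y j = x j -> z j = x j -> l y = l z) -> cup ls S x = 0.
Proof.
elim: ls S x => // l' ls IH S x; rewrite inE => + jS lc.
have xij i : i \in S -> step i x j = x j.
  by move=> iS; rewrite step_neq //; apply: contraNneq jS => ->.
case/orP => [/eqP <- | lls] /=; apply: big1 => i iS.
  by rewrite (lc _ x) ?xij // subrr mul0r.
rewrite IH ?mulr0 // ?inE ?(negbTE jS) ?andbF //.
by move=> y z; rewrite xij //; apply: lc.
Qed.

(** A monotone path with a nonzero contribution crosses, for each cochain of the
product, an edge along which this cochain changes. *)
Lemma cup_change ls S x l : cup ls S x != 0 -> l \in ls ->
  exists y z, [/\ forall i, (x i <= y i <= x i + (i \in S))%N,
                  forall i, (x i <= z i <= x i + (i \in S))%N & l y != l z].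
Proof.
elim: ls S x => // l' ls IH S x /= sum_neq0.
have [j jS] : exists2 j, j \in S &
    (l' (step j x) - l' x) * cup ls (del S j) (step j x) != 0.
  apply/exists_inP; apply: contraNT sum_neq0 => /exists_inPn cup0.
  by apply/eqP; apply: big1 => j /cup0; rewrite negbK => /eqP.
move: jS; rewrite mulf_eq0 negb_or subr_eq0 => jS /andP[l'j cup_neq0].
rewrite inE => /orP[/eqP -> | lls].
  exists (step j x), x; split=> // i; last by rewrite leqnn leq_addr.
  by rewrite /step leq_addr leq_add2l; case: eqP => // ->; rewrite jS.
have [y [z [xy xz lyz]]] := IH _ _ cup_neq0 lls.
have widen w :
      (forall i, (step j x i <= w i <= step j x i + (i \in del S j))%N) ->
    forall i, (x i <= w i <= x i + (i \in S))%N.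
  move=> xw i; have := xw i; rewrite /step !inE.
  case: eqP => [-> | _]; last by rewrite addn0.
  by rewrite jS /= addn0 addn1 => /andP[/ltnW -> ->].
by exists y, z; split=> //; apply: widen.
Qed.

Lemma updC x i j a b : i != j -> upd (upd x i a) j b = upd (upd x j b) i a.
Proof.
move=> ij; apply/funext => k; rewrite /upd; case: eqP => // ->.
by rewrite eq_sym (negbTE ij).
Qed.

Lemma boxsum_step N s F j x : j \notin s ->
  boxsum N s (fun y => F (step j y)) x = boxsum N s F (step j x).
Proof.
elim: s x => //= i s IH x; rewrite inE negb_or => /andP[ji js].
apply: eq_bigr => k _; rewrite IH //; congr boxsum; apply/funext => h.
by rewrite /upd /step; case: eqP => // ->; rewrite eq_sym (negbTE ji) addn0.
Qed.

Lemma boxsumB N s F G x :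
  boxsum N s (fun y => F y - G y) x = boxsum N s F x - boxsum N s G x.
Proof. by elim: s x => //= j s IH x; rewrite -sumrB; apply: eq_bigr. Qed.

Lemma boxsum_sum N s S (F : I -> (I -> nat) -> 'F_2) x :
  boxsum N s (fun y => \sum_(j in S) F j y) x =
  \sum_(j in S) boxsum N s (F j) x.
Proof.
elim: s x => //= i s IH x; rewrite exchange_big /=.
by apply: eq_bigr => k _.
Qed.

Lemma boxsum_eq N s F G x :
  (forall y, (forall j, j \notin s -> y j = x j) -> F y = G y) ->
  boxsum N s F x = boxsum N s G x.
Proof.
elim: s x => /= [|i s IH] x FG; first exact: FG.
apply: eq_bigr => k _; apply: IH => y yx; apply: FG => j.
by rewrite inE negb_or => /andP[/negbTE ji /yx ->]; rewrite /upd ji.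
Qed.

Lemma boxsum_telescope N s F j x : uniq s -> j \in s ->
  boxsum N s (fun y => F (step j y) - F y) x =
  boxsum N (rem j s) F (upd x j N) - boxsum N (rem j s) F (upd x j 0).
Proof.
elim: s x => //= i s IH x /andP[iNs us]; rewrite inE eq_sym.
case: eqP iNs => [-> jNs _|/eqP ij _ /= js]; last first.
  by rewrite -sumrB; apply: eq_bigr => k _; rewrite IH // !(updC _ _ _ ij).
rewrite (eq_bigr (fun k : 'I_N =>
  boxsum N s F (upd x j k.+1) - boxsum N s F (upd x j k))); last first.
  move=> k _; rewrite boxsumB boxsum_step //.
  have -> // : step j (upd x j k) = upd x j k.+1.
  by apply/funext => h; rewrite /step /upd; case: eqP; rewrite ?addn1 ?addn0.
rewrite -(big_mkord xpredT (fun k =>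
  boxsum N s F (upd x j k.+1) - boxsum N s F (upd x j k))).
by rewrite telescope_sumr.
Qed.

(** By the Stokes formula the sum reduces to the faces of the box.  The face
[y i = 0] of the first direction contributes 0 because [l i] vanishes on it,
the faces normal to the other directions contribute 0 by [cup_const], and the
face [y i = N], where [l i] is 1, is the same statement in one dimension
less. *)
Lemma boxsum_cup N (l : I -> (I -> nat) -> 'F_2) s x : uniq s ->
  (forall i y, i \in s -> y i = 0%N -> l i y = 0) ->
  (forall i y, i \in s -> y i = N -> l i y = 1) ->
  boxsum N s (cup [seq l i | i <- s] [set i in s]%SET) x = 1.
Proof.
elim: s x => //= i s IH x /andP[iNs us] l0 lN.
set S := [set _ in _]%SET.
have iS : i \in S by rewrite inE mem_head.
have delSi : del S i = [set j in s]%SET.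
  apply/setP => j; rewrite !inE; case: eqP => //= ->; exact/esym/negbTE.
rewrite -/(boxsum N (i :: s) _ x).
pose G j y := l i y * cup [seq l k | k <- s] (del S j) y.
rewrite (@boxsum_eq _ _ _ (fun y =>
  \sum_(j in S) (G j (step j y) - G j y))); last first.
  by move=> y _; rewrite -cup_stokes.
rewrite boxsum_sum (eq_bigr (fun j =>
  boxsum N (rem j (i :: s)) (G j) (upd x j N) -
  boxsum N (rem j (i :: s)) (G j) (upd x j 0))); last first.
  by move=> j; rewrite inE => js; rewrite boxsum_telescope //= iNs.
rewrite (big_setD1 i iS) /= eqxx.
rewrite [X in _ - X + _](@boxsum_eq _ _ _ (fun y => 0)); last first.
  move=> y /(_ i iNs); rewrite /upd eqxx /G => /l0 ->; first by rewrite mul0r.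
  exact: mem_head.
rewrite (@boxsum_eq _ _ _
  (cup [seq l k | k <- s] [set j in s]%SET)); last first.
  move=> y /(_ i iNs); rewrite /upd eqxx /G delSi => /lN ->.
    by rewrite mul1r.
  exact: mem_head.
rewrite IH //; last 2 first.
- by move=> j y js; apply: l0; rewrite inE js orbT.
- by move=> j y js; apply: lN; rewrite inE js orbT.
have boxsum0 r z : boxsum N r (fun=> 0) z = 0.
  by elim: r z => //= j r IHr z; apply: big1.
rewrite boxsum0 subr0 big1 ?addr0 // => j; rewrite delSi inE => js.
have jNr : j \notin rem j (i :: s) by rewrite mem_rem_uniqF //= iNs us.
have face0 c (ljc : forall y z, y j = c -> z j = c -> l j y = l j z) :
    boxsum N (rem j (i :: s)) (G j) (upd x j c) = 0.
  rewrite (@boxsum_eq _ _ _ (fun y => 0)) // => y /(_ j jNr).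
  rewrite /upd eqxx => yjc.
  rewrite /G (cup_const (l := l j) (j := j)) ?mulr0 //.
  - by apply/mapP; exists j.
  - by rewrite !inE eqxx.
  - by rewrite yjc.
have jis : j \in i :: s by rewrite inE js orbT.
rewrite !face0 ?subr0 //.
  by move=> y z /l0 -> // /l0 ->.
by move=> y z /lN -> // /lN ->.
Qed.

Lemma boxsum_neq0 N s F x : boxsum N s F x != 0 ->
  exists y, [/\ forall i, i \in s -> (y i < N)%N,
                forall i, i \notin s -> y i = x i & F y != 0].
Proof.
elim: s x => [|j s IH] x /= sum_neq0; first by exists x.
have [k kP] : exists k : 'I_N, boxsum N s F (upd x j k) != 0.
  apply/existsP; apply: contraNT sum_neq0 => /existsPn sum0.
  by apply/eqP; apply: big1 => k _; have := sum0 k; rewrite negbK => /eqP.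
have [y [ys yNs Fy]] := IH _ kP; exists y; split=> // i; rewrite inE.
  have [/ys //|/yNs ->] := boolP (i \in s).
  by rewrite orbF /upd => ->; apply: ltn_ord.
by rewrite negb_or => /andP[/negbTE ij /yNs ->]; rewrite /upd ij.
Qed.

Lemma cubical_sperner N (l : I -> (I -> nat) -> bool) :
  (forall i y, y i = 0%N -> l i y = false) ->
  (forall i y, y i = N -> l i y) ->
  exists2 x, forall i, (x i < N)%N &
    forall i, exists y z, [/\ forall k, (x k <= y k <= (x k).+1)%N,
      forall k, (x k <= z k <= (x k).+1)%N, l i y = false & l i z].
Proof.
move=> l0 lN; pose L i y : 'F_2 := (l i y)%:R.
have : boxsum N (enum I) (cup [seq L i | i <- enum I] [set i in enum I]%SET)
         (fun=> 0%N) != 0.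
  rewrite boxsum_cup ?enum_uniq ?oner_neq0 // => i y _.
    by move=> /l0; rewrite /L => ->.
  by move=> /lN; rewrite /L => ->.
move=> /boxsum_neq0[x [xN _ cup_neq0]]; exists x => [i|i].
  by apply: xN; rewrite mem_enum.
have [|y [z [xy xz lyz]]] := cup_change (l := L i) cup_neq0.
  by apply: map_f; rewrite mem_enum.
have {}xy k : (x k <= y k <= (x k).+1)%N.
  by have := xy k; rewrite !inE mem_enum addn1.
have {}xz k : (x k <= z k <= (x k).+1)%N.
  by have := xz k; rewrite !inE mem_enum addn1.
case ly : (l i y); case lz : (l i z); move: lyz; rewrite /L ly lz ?eqxx // => _.
  by exists z, y.
by exists y, z.
Qed.

End Cup.

(** * The variational inequality on a cube *)

Section CubeVI.
Variables (R : realType) (n : nat).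
Implicit Types (x : 'rV[R]_n) (F : 'rV[R]_n -> 'rV[R]_n).

Lemma continuous_coordinate F i : continuous F -> continuous (fun x => F x 0 i).
Proof.
move=> Fc x; apply: (@continuous_comp _ _ _ F (fun v => v 0 i)) (Fc x) _.
exact: coord_continuous.
Qed.

Lemma near_gt (h : 'rV[R]_n -> R) a x : continuous h -> a < h x ->
  \forall z \near x, a < h z.
Proof.
by move=> hc; apply: cvgr_gt (hc x) a.
Qed.

(** This is Brouwer's fixed point theorem for the cube in the form of a
variational inequality: the conditions say that [x] is fixed by the map sending
[z] to the projection of [z - F z] on the cube.  On a grid of mesh [h N], label
a point by the signs of the coordinates of [F], overruled on the boundary as
the Sperner lemma demands.  The cubes it provides accumulate at a point [x]
close to which each coordinate has vertices with either label. *)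
Lemma cube_variational_inequality F (K : R) : 0 < K -> continuous F ->
  exists x, forall i, [/\ `|x 0 i| <= K,
    - K < x 0 i -> F x 0 i <= 0 & x 0 i < K -> 0 <= F x 0 i].
Proof.
move=> K0 Fc.
pose h N : R := 2 * K / N.+1%:R.
have h0 N : 0 < h N by rewrite divr_gt0 ?mulr_gt0 ?ltr0n.
pose pt N (y : 'I_n -> nat) : 'rV[R]_n := \row_i (- K + h N * (y i)%:R).
pose l N i y := (y i == N.+1) || (y i != 0%N) && (0 < F (pt N y) 0 i).
have /choice[c cP] N : exists c : 'I_n -> nat, (forall i, (c i < N.+1)%N) /\
    forall i, exists y z, [/\ forall k, (c k <= y k <= (c k).+1)%N,
      forall k, (c k <= z k <= (c k).+1)%N, l N i y = false & l N i z].
  have [||c cN cl] := @cubical_sperner _ N.+1 (l N).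
  - by move=> i y; rewrite /l => ->.
  - by move=> i y; rewrite /l => ->; rewrite eqxx.
  - by exists c.
have cube_compact :
    compact [set v : 'rV[R]_n | forall i, `[- K, K]%classic (v 0 i)].
  by apply: (@rV_compact R n (fun=> `[- K, K]%classic)) => i;
     apply: segment_compact.
pose u N := pt N (c N).
have uK : (u @ \oo) [set v : 'rV[R]_n | forall i, `[- K, K]%classic (v 0 i)].
  exists 0%N => // N _ i /=; rewrite in_itv /= mxE lerDl.
  rewrite mulr_ge0 ?(ltW (h0 N)) //=.
  have : h N * (c N i)%:R <= 2 * K.
    rewrite /h mulrAC ler_pdivrMr ?ltr0n // ler_pM2l ?mulr_gt0 // ler_nat.
    by rewrite ltnW //; case: (cP N).
  lra.
have [x [xK xcl]] := cube_compact _ _ uK.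
(* All the vertices of some of the cubes [c N] are as close to [x] as wanted. *)
have approx U : nbhs x U -> exists N, forall y,
    (forall k, (c N k <= y k <= (c N k).+1)%N) -> U (pt N y).
  move=> /nbhs_ballP[e /= e0 xeU].
  have [N0 N0e] : exists N0, forall N, (N0 <= N)%N -> h N < e / 2.
    have eK0 : 0 < e / 2 / (2 * K) by rewrite !divr_gt0 ?mulr_gt0.
    have [N0 _ N0P] := near_infty_natSinv_lt (PosNum eK0).
    exists N0 => N /N0P /=; rewrite ltr_pdivlMr ?mulr_gt0 //.
    by rewrite mulrC.
  have [_ [[N N0N <-] xuN]] :
      [set u N | N in [set N | (N0 <= N)%N]] `&` ball x (e / 2) !=set0.
    apply: xcl; last by apply: nbhsx_ballx; rewrite divr_gt0.
    by exists N0 => // N /= N0N; exists N.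
  exists N => y ycN; apply: xeU; rewrite (splitr e).
  apply: ball_triangle xuN _; split=> [|i j]; first by rewrite divr_gt0.
  rewrite /ball /= !mxE opprD addrACA opprK addNr add0r -mulrBr.
  rewrite normrM gtr0_norm //.
  apply: le_lt_trans (N0e _ N0N); rewrite ger_pMr // distrC.
  have /andP[cy yc] := ycN j.
  rewrite -natrB // ger0_norm // (_ : 1 = 1%:R) // ler_nat.
  by rewrite leq_subLR addn1.
exists x => i; have := xK i; rewrite /= in_itv /= => /andP[Kx xK'].
split; first by rewrite ler_norml Kx.
- move=> xi; rewrite leNgt; apply/negP => Fxi.
  have /approx[N NP] : nbhs x [set z : 'rV[R]_n | - K < z 0 i /\ 0 < F z 0 i].
    apply: filterI.
      by apply: near_gt xi; apply: coord_continuous.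
    by apply: near_gt Fxi; apply: continuous_coordinate.
  have [_ /(_ i)[y [_ [/NP[pty Fy] _ + _]]]] := cP N.
  rewrite /l Fy andbT => /negbT; rewrite negb_or negbK => /andP[_ /eqP y0].
  by move: pty; rewrite mxE y0 mulr0 addr0 ltxx.
- move=> xi; rewrite leNgt; apply/negP => Fxi.
  have /approx[N NP] :
      nbhs x [set z : 'rV[R]_n | - K < - z 0 i /\ 0 < - F z 0 i].
    apply: filterI.
      apply: (@near_gt (fun z : 'rV[R]_n => - z 0 i)); last by rewrite ltrN2.
      by move=> z; apply: continuousN; apply: coord_continuous.
    apply: (@near_gt (fun z : 'rV[R]_n => - F z 0 i)); last by rewrite oppr_gt0.
    by move=> z; apply: continuousN; apply: continuous_coordinate.
  have [_ /(_ i)[_ [z [_ /NP[ptz Fz] _]]]] := cP N.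
  rewrite /l; case: ltP => [|_]; first by rewrite ltNge ltW // -oppr_gt0.
  rewrite andbF orbF => /eqP zN; move: ptz; rewrite mxE zN ltrN2.
  by rewrite /h divfK ?pnatr_eq0 //; lra.
Qed.

End CubeVI.

(** * Growth of polynomial maps *)

Section RowNorm.
Variables (R : realType) (n : nat).
Implicit Types (x : 'rV[R]_n).

Lemma coord_le_norm x i : `|x 0 i| <= `|x|.
Proof.
rewrite [leRHS]/Num.Def.normr /= mx_normrE; apply/bigmax_geP; right.
by exists (0, i).
Qed.

Lemma row_norm_le x (a : R) : 0 <= a -> (forall i, `|x 0 i| <= a) -> `|x| <= a.
Proof.
move=> a0 xa; rewrite [leLHS]/Num.Def.normr /= mx_normrE; apply/bigmax_leP.
by split=> // -[i j] _ /=; rewrite ord1.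
Qed.

Lemma row_continuous (T : topologicalType) (F : T -> 'rV[R]_n) :
  (forall i, continuous (fun t : T => F t 0 i)) -> continuous F.
Proof.
move=> Fc x; apply/cvg_ballP => e e0.
have : \forall y \near x, forall i, ball (F x 0 i) e (F y 0 i).
  apply: filter_forall => i.
  by have /cvg_ballP := Fc i x; apply.
by apply: filterS => y Fy; split=> // i j; rewrite ord1.
Qed.

End RowNorm.

Section Asymptotics.
Variables (R : realType) (n : nat).
Implicit Types (f g p q : polymap R n) (x u : 'rV[R]_n) (P : mpoly n R).

Lemma meval_continuous P : continuous (fun x => meval (x 0) P).
Proof.
under [X in continuous X]funext => x do rewrite mevalE.
apply: (@continuous_big R _ +%R 0 xpredT) => [|m _].
  exact: (@add_continuous R^o).
move=> x; have cM : {for x, continuous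
    (fun x : 'rV[R]_n => \prod_i x 0 i ^+ m i)}; last first.
  exact: (cvgM (cvg_cst _) cM).
move: x.
apply: (@continuous_big R _ *%R 1 xpredT) => [|i _].
  exact: mul_continuous.
move=> {}x; apply: (@continuous_comp _ _ _ (fun x : 'rV[R]_n => x 0 i)
  (fun t => t ^+ m i)).
  exact: coord_continuous.
exact: exprn_continuous.
Qed.

Lemma pm_eval_continuous f : continuous (pm_eval f).
Proof.
apply: row_continuous => i; under [X in continuous X]funext => x do rewrite mxE.
exact: meval_continuous.
Qed.

Lemma pm_evalD f g x : pm_eval (f + g) x = pm_eval f x + pm_eval g x.
Proof. by apply/rowP => i; rewrite !mxE mevalD. Qed.

Lemma monomial_norm_le (m : multinom n) d x : (mdeg m <= d)%N -> 1 <= `|x| ->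
  `|\prod_i x 0 i ^+ m i| <= `|x| ^+ d.
Proof.
move=> md x1; rewrite normr_prod.
apply: (@le_trans _ _ (`|x| ^+ mdeg m)); last exact: ler_weXn2l.
rewrite mdegE expr_sum; apply: ler_prod => i _.
by rewrite normr_ge0 normrX lerXn2r ?nnegrE // coord_le_norm.
Qed.

Lemma mdeg_le_pm_degree f i m :
  m \in msupp (f 0 i) -> (mdeg m <= pm_degree f)%N.
Proof.
move=> /(mmeasure_mnm_lt mdeg) mf; apply: leq_trans (leq_bigmax i).
by rewrite -ltnS; case: mmeasure mf.
Qed.

Lemma leading_term_homog f t x :
  pm_eval (leading_term f) (t *: x) =
  t ^+ pm_degree f *: pm_eval (leading_term f) x.
Proof.
apply/rowP => i; rewrite !mxE !mevalE big_distrr /=.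
rewrite big_seq [RHS]big_seq; apply: eq_bigr => m mP.
have <- : mdeg m = pm_degree f by apply/dhomogP: m mP; apply: pihomogP.
rewrite mulrCA mdegE expr_sum -big_split /=; congr (_ * _).
by apply: eq_bigr => j _; rewrite mxE exprMn.
Qed.

(** The bound is [O(|x| ^ (deg f - 1))], multiplied by [|x|] so as to avoid
the truncated exponent. *)
Lemma lower_terms_bound f p : (0 < pm_degree f)%N ->
  (pm_degree p <= pm_degree f - 1)%N ->
  exists2 C, 0 <= C & forall x i, 1 <= `|x| ->
    `|(pm_eval (f + p) x - pm_eval (leading_term f) x) 0 i| * `|x|
      <= C * `|x| ^+ pm_degree f.
Proof.
set d := pm_degree f => d0 dp.
pose low i := [seq m <- msupp (f 0 i) | mdeg m != d].
pose Cf i := \sum_(m <- low i) `|mcoeff m (f 0 i)|.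
pose Cp i := \sum_(m <- msupp (p 0 i)) `|mcoeff m (p 0 i)|.
have C0 i : 0 <= Cf i + Cp i by rewrite addr_ge0 // sumr_ge0.
exists (\sum_i (Cf i + Cp i)) => [|x i x1]; first by rewrite sumr_ge0.
have bound (r : seq (multinom n)) (a : multinom n -> R) :
    (forall m, m \in r -> (mdeg m <= d - 1)%N) ->
    `|\sum_(m <- r) a m * \prod_j x 0 j ^+ m j| <=
    (\sum_(m <- r) `|a m|) * `|x| ^+ (d - 1).
  move=> rd; apply: le_trans (ler_norm_sum _ _ _) _; rewrite big_distrl /=.
  rewrite big_seq [leRHS]big_seq; apply: ler_sum => m mr.
  by rewrite normrM ler_wpM2l // monomial_norm_le // rd.
have -> : (pm_eval (f + p) x - pm_eval (leading_term f) x) 0 i =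
    \sum_(m <- low i) mcoeff m (f 0 i) * \prod_j x 0 j ^+ m j +
    \sum_(m <- msupp (p 0 i)) mcoeff m (p 0 i) * \prod_j x 0 j ^+ m j.
  rewrite pm_evalD addrAC !mxE -mevalE; congr (_ + _).
  have -> : meval (x 0) (pihomog mdeg d (f 0 i)) =
      \sum_(m <- msupp (f 0 i) | mdeg m == d)
      mcoeff m (f 0 i) * \prod_j x 0 j ^+ m j.
    rewrite pihomogE (raddf_sum (meval (x 0))) /=.
    by apply: eq_bigr => m _; rewrite mevalZ mevalX.
  rewrite mevalE (bigID (fun m => mdeg m == d)) /= addrAC subrr add0r.
  by rewrite big_filter.
have -> : `|x| ^+ d = `|x| ^+ (d - 1) * `|x| by rewrite -exprSr subn1 prednK.
rewrite mulrA ler_wpM2r //; apply: le_trans (ler_normD _ _) _.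
apply: (@le_trans _ _ ((Cf i + Cp i) * `|x| ^+ (d - 1))); last first.
  by rewrite ler_wpM2r ?exprn_ge0 // (bigD1 i) //= lerDl sumr_ge0.
rewrite mulrDl lerD //; apply: bound => m.
  rewrite mem_filter => /andP[md /mdeg_le_pm_degree].
  by rewrite leq_eqVlt (negbTE md) /= => mf; rewrite -ltnS subn1 prednK.
by move=> /mdeg_le_pm_degree /leq_trans; apply.
Qed.

(** This is what makes two different degrees harmless: the zeros of a minimum
do not see separate positive rescalings of its arguments. *)
Lemma min_scale_eq0 (s t a b : R) : 0 < s -> 0 < t ->
  Num.min (s * a) (t * b) = 0 -> Num.min a b = 0.
Proof.
move=> s0 t0; case: (leP (s * a)) => sab /eqP;
  rewrite mulf_eq0 ?(gt_eqF s0) ?(gt_eqF t0) /= => /eqP ab0.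
  rewrite ab0 min_l // -(pmulr_rge0 b t0).
  by move: sab; rewrite ab0 mulr0.
rewrite ab0 min_r // ltW // -(pmulr_rgt0 a s0).
by move: sab; rewrite ab0 mulr0.
Qed.

Lemma min_near0 (a b a' b' e : R) : `|a - a'| <= e -> `|b - b'| <= e ->
  Num.min a b = 0 -> `|Num.min a' b'| <= e.
Proof.
by rewrite !ler_distl ler_norml; case: (leP a b); case: (leP a' b') => *; lra.
Qed.

End Asymptotics.

(** * The solution set as a zero set, and the deformation *)

Section Main.
Variables (R : realType) (n : nat).
Implicit Types (f g p q : polymap R n) (x u : 'rV[R]_n).

Lemma SOL_cminE f g : SOL f g = [set x | cmin (pm_eval f x) (pm_eval g x) = 0].
Proof.
apply/seteqP; split=> x /=.
- move=> [f0 g0 fg0]; apply/rowP => i; rewrite !mxE.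
  have /eqP : pm_eval f x 0 i * pm_eval g x 0 i = 0.
    by apply: (psumr_eq0P _ fg0) => // j _; rewrite mulr_ge0.
  rewrite mulf_eq0 => /orP[]; rewrite !mxE => /eqP ->.
    by rewrite min_l //; have := g0 i; rewrite mxE.
  by rewrite min_r //; have := f0 i; rewrite mxE.
- move=> fg0.
  have fgi i : Num.min (pm_eval f x 0 i) (pm_eval g x 0 i) = 0.
    by have /rowP/(_ i) := fg0; rewrite !mxE.
  split=> [i|i|].
  + by rewrite -(fgi i) ge_min lexx.
  + by rewrite -(fgi i) ge_min lexx orbT.
  + apply: big1 => i _; have := fgi i.
    by case: leP => _ ->; rewrite ?mul0r ?mulr0.
Qed.

Lemma cmin_continuous (F G : 'rV[R]_n -> 'rV[R]_n) :
  continuous F -> continuous G -> continuous (fun x => cmin (F x) (G x)).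
Proof.
move=> Fc Gc; apply: row_continuous => i.
under [X in continuous X]funext => x do rewrite mxE.
by move=> x; apply: (@continuous_min R); apply: continuous_coordinate.
Qed.

Lemma min_leading_continuous f g : continuous (min_leading f g).
Proof. by apply: cmin_continuous; apply: pm_eval_continuous. Qed.

Lemma min_leading_ray f g t u : 0 < t -> min_leading f g u = 0 ->
  min_leading f g (t *: u) = 0.
Proof.
move=> t0 /rowP m0; apply/rowP => i; have := m0 i.
rewrite /min_leading /cmin !leading_term_homog !mxE => min0.
have td d : t ^+ d != 0 by rewrite expf_neq0 ?gt_eqF.
by apply: (@min_scale_eq0 _ (t ^- pm_degree f) (t ^- pm_degree g));
   rewrite ?invr_gt0 ?exprn_gt0 // !mulKf.
Qed.

Lemma bounded_set_norm_le (A : set 'rV[R]_n) :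
  bounded_set A <-> exists M, forall x, A x -> `|x| <= M.
Proof.
split=> [[M [_ AM]]|[M AM]].
  by exists (M + 1) => x /AM; apply; rewrite ltrDl.
exists M; split=> [|N /ltW MN x /AM]; first exact: num_real.
by move=> /le_trans; apply.
Qed.

(** A zero [u] on the unit sphere would give a ray of zeros, all of which lie
in the set that is supposed to be bounded.  Compactness of the sphere then
turns the absence of zeros into a lower bound. *)
Lemma min_leading_sphere_lower_bound f g :
  (exists xref, bounded_set
    [set x | dotprod (x - xref) (min_leading f g x) <= 0]) ->
  exists2 delta, 0 < delta &
    forall u, `|u| = 1 -> delta <= `|min_leading f g u|.
Proof.
move=> [xref bnd].
have [M MP] := (bounded_set_norm_le _).1 bnd.
have m_neq0 u : `|u| = 1 -> min_leading f g u != 0.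
  move=> u1; apply/eqP => m0.
  pose t := Num.max M 0 + 1.
  have t0 : 0 < t by rewrite ltr_wpDl // le_max lexx orbT.
  have : `|t *: u| <= M.
    apply: MP; rewrite /= min_leading_ray // /dotprod.
    by rewrite big1 // => i _; rewrite [X in _ * X]mxE mulr0.
  rewrite normrZ u1 mulr1 gtr0_norm // leNgt /t ltr_pwDr //.
  by rewrite le_max lexx.
pose S := [set u : 'rV[R]_n | `|u| = 1].
have [S0|S0] := pselect (S !=set0); last first.
  by exists 1 => // u u1; case: S0; exists u.
have Sc : compact S.
  apply: bounded_closed_compact.
    apply/bounded_set_norm_le; exists 1 => u /= ->; exact: lexx.
  rewrite (_ : S = Num.norm @^-1` [set 1]) //.
  apply: (preimage_closed _ (@closed_eq R 1)).
  by move=> u _; apply: norm_continuous.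
have [|c cS cmin] := @compact_EVT_min _ R
  (fun u => `|min_leading f g u|) S S0 Sc.
  apply: continuous_subspaceT => u.
  apply: (@continuous_comp _ _ _ (min_leading f g) Num.norm).
    exact: min_leading_continuous.
  exact: norm_continuous.
exists `|min_leading f g c|.
  by rewrite normr_gt0 m_neq0 //; exact: set_mem.
by move=> u u1; apply: cmin; exact: mem_set.
Qed.

Definition blend f p (lambda : R) x : 'rV[R]_n :=
  pm_eval (leading_term f) x
  + lambda *: (pm_eval (f + p) x - pm_eval (leading_term f) x).

(** After division by [|x| ^ deg f] a blend is a perturbation of order
[1 / |x|] of the leading term at [x / |x|], whatever [lambda]. *)
Lemma blend_coord_bound f p C x i (lambda : R) :
  0 <= lambda <= 1 -> 0 < `|x| ->
  `|(pm_eval (f + p) x - pm_eval (leading_term f) x) 0 i| * `|x|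
      <= C * `|x| ^+ pm_degree f ->
  exists2 a, blend f p lambda x 0 i = `|x| ^+ pm_degree f * a
    & `|a - pm_eval (leading_term f) (`|x|^-1 *: x) 0 i| <= C / `|x|.
Proof.
pose e := (pm_eval (f + p) x - pm_eval (leading_term f) x) 0 i.
rewrite -/e => l01 x0 eC.
have xd0 : 0 < `|x| ^+ pm_degree f by rewrite exprn_gt0.
exists (pm_eval (leading_term f) (`|x|^-1 *: x) 0 i +
  lambda * e / `|x| ^+ pm_degree f).
  rewrite mulrDr [X in _ = _ + X]mulrC divfK ?gt_eqF //.
  rewrite leading_term_homog exprVn [X in _ = _ * X + _]mxE mulrA.
  rewrite divff ?gt_eqF // mul1r.
  by rewrite mxE [X in _ + X]mxE.
rewrite addrAC subrr add0r 2!normrM normfV [`|_ ^+ _|]gtr0_norm //.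
rewrite ler_pdivlMr // mulrAC ler_pdivrMr // (le_trans _ eC) //.
by have /andP[l0 l1] := l01; rewrite ler_wpM2r // ler_piMl // ger0_norm.
Qed.

Lemma blend_zeros_bounded f g p q :
  (0 < pm_degree f)%N -> (0 < pm_degree g)%N ->
  (exists xref, bounded_set
    [set x | dotprod (x - xref) (min_leading f g x) <= 0]) ->
  (pm_degree p <= pm_degree f - 1)%N -> (pm_degree q <= pm_degree g - 1)%N ->
  exists r : R, forall lambda x, 0 <= lambda <= 1 ->
    cmin (blend f p lambda x) (blend g q lambda x) = 0 -> `|x| <= r.
Proof.
move=> f0 g0 /min_leading_sphere_lower_bound[delta d0 dP] pf qg.
have [Cf Cf0 CfP] := lower_terms_bound f0 pf.
have [Cg Cg0 CgP] := lower_terms_bound g0 qg.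
pose C := Cf + Cg.
exists (Num.max 1 (C / delta)) => lambda x l01 /rowP zero.
rewrite leNgt; apply/negP; rewrite gt_max => /andP[x1 xC].
have x0 : 0 < `|x| by apply: lt_trans x1.
suff : `|min_leading f g (`|x|^-1 *: x)| <= C / `|x|.
  apply/negP; rewrite -ltNge; apply: (@lt_le_trans _ _ delta).
    by rewrite ltr_pdivrMr // mulrC -ltr_pdivrMr.
  by apply: dP; rewrite normrZ normfV normr_id mulVf ?gt_eqF.
apply: row_norm_le => [|i]; first by rewrite divr_ge0 ?addr_ge0.
have [a aE aP] := blend_coord_bound l01 x0 (CfP x i (ltW x1)).
have [b bE bP] := blend_coord_bound l01 x0 (CgP x i (ltW x1)).
have := zero i; rewrite /min_leading /cmin mxE [RHS]mxE aE bE.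
move=> /min_scale_eq0 ab0; rewrite mxE.
apply: min_near0 (ab0 _ _); rewrite ?exprn_gt0 //.
  by apply: le_trans aP _; rewrite ler_pM2r ?invr_gt0 // lerDl.
by apply: le_trans bP _; rewrite ler_pM2r ?invr_gt0 // lerDr.
Qed.

Lemma blend_continuous f p (lambda : 'rV[R]_n -> R) : continuous lambda ->
  continuous (fun x => blend f p (lambda x) x).
Proof.
move=> lc x; have fc h := @pm_eval_continuous R n h x.
exact: (cvgD (fc _) (cvgZ (lc x) (cvgB (fc _) (fc _)))).
Qed.

Lemma blend0 f p x : blend f p 0 x = pm_eval (leading_term f) x.
Proof. by rewrite /blend scale0r addr0. Qed.

Lemma blend1 f p x : blend f p 1 x = pm_eval (f + p) x.
Proof. by rewrite /blend scale1r addrC subrK. Qed.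

Definition cutoff (r : R) x : R := Num.min 1 (Num.max 0 (2 - `|x| / r)).

Lemma cutoff_itv r x : 0 <= cutoff r x <= 1.
Proof. by rewrite /cutoff le_min ge_min le_max !lexx ler01. Qed.

Lemma cutoff_in r x : 0 < r -> `|x| <= r -> cutoff r x = 1.
Proof.
move=> r0 xr; rewrite /cutoff min_l // le_max; apply/orP; right.
have : `|x| / r <= 1 by rewrite ler_pdivrMr // mul1r.
lra.
Qed.

Lemma cutoff_out r x : 0 < r -> 2 * r <= `|x| -> cutoff r x = 0.
Proof.
move=> r0 xr; rewrite /cutoff [X in Num.min _ X]max_l ?min_r //.
by rewrite subr_le0 ler_pdivlMr.
Qed.

Lemma cutoff_continuous r : continuous (cutoff r).
Proof.
move=> x; apply: (@continuous_min R _ (fun=> 1)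
  (fun z : 'rV[R]_n => Num.max 0 (2 - `|z| / r))).
  exact: (@cst_continuous _ _ (1 : R^o) x).
apply: (@continuous_max R _ (fun=> 0) (fun z : 'rV[R]_n => 2 - `|z| / r)).
  exact: (@cst_continuous _ _ (0 : R^o) x).
exact: (cvgB (cvg_cst _) (cvgM (@norm_continuous _ _ x) (cvg_cst _))).
Qed.

End Main.

(** * Existence and compactness *)

Theorem proposition4p5 (R : realType) (n : nat) (f g : polymap R n)
    (df_gt0 : (0 < pm_degree f)%N) (dg_gt0 : (0 < pm_degree g)%N)
    (hbounded : exists xref : 'rV[R]_n,
       bounded_set [set x : 'rV[R]_n |
         dotprod (x - xref) (min_leading f g x) <= 0]) :
  forall p q : polymap R n,
    (pm_degree p <= pm_degree f - 1)%N ->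
    (pm_degree q <= pm_degree g - 1)%N ->
    SOL (f + p) (g + q) !=set0 /\ compact (SOL (f + p) (g + q)).
Proof.
move=> p q pf qg; rewrite SOL_cminE.
have [r rP] := blend_zeros_bounded df_gt0 dg_gt0 hbounded pf qg.
have zero_le x : cmin (pm_eval (f + p) x) (pm_eval (g + q) x) = 0 -> `|x| <= r.
  by rewrite -!blend1; apply: rP; rewrite lexx ler01.
split; last first.
  apply: bounded_closed_compact; first by apply/bounded_set_norm_le; exists r.
  pose m x := cmin (pm_eval (f + p) x) (pm_eval (g + q) x).
  rewrite (_ : mkset _ = m @^-1` [set 0]) //; apply: preimage_closed.
    by move=> x _; apply: cmin_continuous; apply: pm_eval_continuous.
  exact: accessible_closed_set1 (hausdorff_accessible (@norm_hausdorff _ _)) _.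
have [xref bnd] := hbounded.
have [M MP] := (bounded_set_norm_le _).1 bnd.
(* [r1] exceeds the bound [r] on zeros, while [2 * r1] exceeds both the bound
   [M] of the given set and the norm of [xref]. *)
pose r1 := Num.max r 0 + Num.max M 0 + `|xref| + 1.
have maxr0 : r <= Num.max r 0 /\ 0 <= Num.max r 0 by rewrite !le_max !lexx orbT.
have maxM0 : M <= Num.max M 0 /\ 0 <= Num.max M 0 by rewrite !le_max !lexx orbT.
have ref0 := normr_ge0 xref.
have r10 : 0 < r1 by rewrite /r1; lra.
pose F x := cmin (blend f p (cutoff r1 x) x) (blend g q (cutoff r1 x) x).
have Fc : continuous F.
  by apply: cmin_continuous; apply: blend_continuous; apply: cutoff_continuous.
have K0 : 0 < 2 * r1 by rewrite mulr_gt0.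
have [x xP] := cube_variational_inequality K0 Fc.
(* Test the variational inequality against [xref], a point of the cube. *)
have xF : dotprod (x - xref) (F x) <= 0.
  apply: sumr_le0 => i _; have [xK F_le0 F_ge0] := xP i.
  have refi := coord_le_norm xref i.
  have refK : `|xref 0 i| < 2 * r1 by rewrite /r1; lra.
  move: refK; rewrite ltr_norml mxE [(- xref) 0 i]mxE => /andP[ref1 ref2].
  have [xi1|xi1] := leP (x 0 i) (- (2 * r1)).
    by rewrite mulr_le0_ge0 ?F_ge0 //; lra.
  have [xi2|xi2] := leP (2 * r1) (x 0 i).
    by rewrite mulr_ge0_le0 ?F_le0 //; lra.
  have -> : F x 0 i = 0 by apply: le_anti; rewrite F_le0 ?F_ge0.
  by rewrite mulr0.
have xK : `|x| < 2 * r1.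
  rewrite ltNge; apply/negP => Kx.
  have : `|x| <= M.
    by apply: MP; move: xF; rewrite /F cutoff_out // !blend0.
  by rewrite /r1 in Kx *; lra.
have Fx0 : F x = 0.
  apply/rowP => i; have [_ F_le0 F_ge0] := xP i; rewrite [RHS]mxE.
  have := le_lt_trans (coord_le_norm x i) xK.
  rewrite ltr_norml => /andP[xi1 xi2].
  by apply: le_anti; rewrite F_le0 ?F_ge0.
have xr : `|x| <= r1.
  apply: (@le_trans _ _ r); last by rewrite /r1; lra.
  by apply: (rP (cutoff r1 x)) => //; apply: cutoff_itv.
by exists x; move: Fx0; rewrite /F cutoff_in // !blend1.
Qed.
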